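(* Let $2\le s\le t$ be integers and let $x_b,x_g,x_r\in[0,1]$ with $x_b+x_g+x_r=1$. If $\sqrt{x_b}+\sqrt{x_g}\le 1$, then \[ I_3(K'_{s,t},(x_b,x_g)) = x_b^{s/2}x_g^{t/2}\binom{s+t}{s}. \] If $\sqrt{x_b}+\sqrt{x_g}>1$, then \[ I_3(K'_{s,s},(x_b,x_g)) = \left(\frac{x_r}{2}\right)^{s}\binom{2s}{s}. \]
   Context: A $3$-colored complete graph is a complete graph $G=(V,\binom{V}{2})$ together with a coloring $f$ of its edges by the colors blue, green, red. For a color $i$, $\varrho_i(G)=e_i(G)/\binom{|V|}{2}$, where $e_i(G)$ is the number of edges of color $i$. For a $3$-colored complete graph $F$ on $\sigma$ vertices with coloring $g$, a set $X\subseteq V$ with $|X|=\sigma$ is a copy of $F$ in $G$ if there is a bijection $\pi:V(F)\to X$ with $g(uv)=f(\pi(u)\pi(v))$ for all distinct $u,v\in V(F)$; $N_3(F,G)$ is the number of copies and $\varrho_3(F,G)=N_3(F,G)/\binom{|V|}{\sigma}$. A sequence $(G_n)_{n\ge1}$ of $3$-colored complete graphs with $|V(G_n)|\to\infty$ is $F$-good if the limits $x_b=\lim\varrho_{\mathrm{blue}}(G_n)$, $x_g=\lim\varrho_{\mathrm{green}}(G_n)$ and $y=\lim\varrho_3(F,G_n)$ exist; it then realizes $(x_b,x_g,y)$. Define $I_3(F,(x_b,x_g))=\sup\{y: (x_b,x_g,y)\text{ is realized by some } F\text{-good sequence}\}$. For $2\le s\le t$, $K'_{s,t}$ is the $3$-colored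 complete graph on $V_1\sqcup V_2$ with $|V_1|=s$, $|V_2|=t$, in which edges inside $V_1$ are blue, edges inside $V_2$ are green, and edges between $V_1$ and $V_2$ are red. *)

(* Defs.v *)
From HB Require Import structures.
From mathcomp Require Import all_boot all_order all_algebra.
From mathcomp Require Import all_classical all_reals all_analysis.
Set Implicit Arguments. Unset Strict Implicit. Unset Printing Implicit Defensive.
Import Order.TTheory GRing.Theory Num.Theory numFieldNormedType.Exports.
Local Open Scope classical_set_scope.
Local Open Scope ring_scope.

Definition color := 'I_3.
Definition blue : color := @Ordinal 3 0 isT.
Definition green : color := @Ordinal 3 1 isT.
Definition red : color := @Ordinal 3 2 isT.

(* A 3-colored complete graph on vertex set 'I_n; the value of the coloring
   on the diagonal is irrelevant (never used). *)
Record col3 := Col3 {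
  cn : nat;
  cf : 'I_cn -> 'I_cn -> color;
  cf_sym : forall u v, cf u v = cf v u }.

Definition ecount (G : col3) (i : color) : nat :=
  #|[set p : 'I_(cn G) * 'I_(cn G) | (p.1 < p.2)%N && (cf p.1 p.2 == i)]|.

Definition rho (R : realType) (G : col3) (i : color) : R :=
  (ecount G i)%:R / ('C(cn G, 2))%:R.

Arguments rho : clear implicits.
Definition is_copy (F G : col3) (X : {set 'I_(cn G)}) : bool :=
  (#|X| == cn F) &&
  [exists pi : {ffun 'I_(cn F) -> 'I_(cn G)},
     [&& injectiveb pi, pi @: setT == X &
        [forall u, forall v, (u != v) ==> (cf u v == cf (pi u) (pi v))]]].

Definition N3 (F G : col3) : nat := #|[set X : {set 'I_(cn G)} | @is_copy F G X]|.

Definition rho3 (R : realType) (F G : col3) : R :=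
  (N3 F G)%:R / ('C(cn G, cn F))%:R.

Definition realizes (R : realType) (F : col3) (Gs : nat -> col3) (xb xg y : R) : Prop :=
  ((fun n => ((cn (Gs n))%:R : R)) @ \oo --> +oo) /\
  ((fun n => rho R (Gs n) blue) @ \oo --> xb) /\
  ((fun n => rho R (Gs n) green) @ \oo --> xg) /\
  ((fun n => rho3 R F (Gs n)) @ \oo --> y).

Definition I3 (R : realType) (F : col3) (xb xg : R) : R :=
  sup [set y : R | exists Gs : nat -> col3, realizes F Gs xb xg y].

Definition Kcol (s t : nat) (u v : 'I_(s + t)) : color :=
  if (u < s)%N && (v < s)%N then blue
  else if (s <= u)%N && (s <= v)%N then green
  else red.
Arguments Kcol : clear implicits.

Lemma Kcol_sym s t u v : Kcol s t u v = Kcol s t v u.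
Proof. by rewrite /Kcol (andbC (u < s)%N) (andbC (s <= u)%N). Qed.

Definition Kst (s t : nat) : col3 := @Col3 (s + t) (Kcol s t) (@Kcol_sym s t).

(* Main.v *)
Require Import Defs.
From HB Require Import structures.
From mathcomp Require Import all_boot all_order all_fingroup all_algebra.
From mathcomp Require Import all_classical all_reals all_analysis.
From mathcomp Require Import ring lra.
Set Implicit Arguments. Unset Strict Implicit. Unset Printing Implicit Defensive.
Import Order.TTheory GRing.Theory Num.Theory numFieldNormedType.Exports.
Local Open Scope ring_scope.

(** Upper bounds.  The copies of [Kst s t], times [s! t!], are counted by the
    colour-preserving injections [pi] of [Kst s t] into [G].  Such a [pi] is made
    of an ordered blue [s]-clique and an ordered green [t]-clique, and a graph with
    [e] edges has at most [(2 e) ^ (k / 2)] ordered [k]-cliques; this gives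
    [xb ^ (s / 2) * xg ^ (t / 2)].  When [s = t], the [s] red edges
    [{pi i, pi (s + i)}] determine [pi], which gives [(xr / 2) ^ s].

    Sharpness.  Take disjoint vertex sets [A] and [B] of proportions [alpha] and
    [beta], colour [A] blue, [B] green and the edges between them red.  With
    [alpha = sqrt xb] and [beta = sqrt xg], colouring all other edges red attains
    the first bound as soon as [alpha + beta <= 1].  Otherwise take
    [alpha = sqrt xb] and [beta = xr / (2 * sqrt xb)] and colour all other edges
    green: [sqrt xb + sqrt xg > 1] is what makes [alpha + beta <= 1]. *)

(** * Ordered cliques counted against ordered edges *)

Section Cliques.
Variables (T : finType) (e : rel T).
Local Open Scope nat_scope.

Definition ordered_cliques (k : nat) : {set {ffun 'I_k -> T}} :=
  [set f : {ffun 'I_k -> T} | [forall i, forall j, (i != j) ==> e (f i) (f j)]].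

Definition ordered_edges : {set T * T} := [set p : T * T | e p.1 p.2].

Lemma ordered_cliquesP k (f : {ffun 'I_k -> T}) :
  reflect (forall i j, i != j -> e (f i) (f j)) (f \in ordered_cliques k).
Proof.
rewrite inE; apply: (iffP forallP) => [H i j ij|H i].
  by have /forallP/(_ j)/implyP/(_ ij) := H i.
by apply/forallP => j; apply/implyP; exact: H.
Qed.

Lemma card_ordered_cliques0 : #|ordered_cliques 0| <= 1.
Proof. by rewrite (leq_trans (max_card _)) // card_ffun card_ord expn0. Qed.

(** Cut off the first two vertices: they form an ordered edge, and the remaining [k] still form a
    clique. *)
Lemma card_ordered_cliquesSS k :
  #|ordered_cliques k.+2| <= #|ordered_cliques k| * #|ordered_edges|.
Proof.
pose h (f : {ffun 'I_k.+2 -> T}) :=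
  ([ffun i => f (lift ord0 (lift ord0 i))] : {ffun 'I_k -> T},
   (f ord0, f (lift ord0 ord0))).
have h_inj : injective h.
  move=> f g [/ffunP fg f0 f1]; apply/ffunP => i.
  case: (unliftP ord0 i) => [j ->|-> //].
  case: (unliftP ord0 j) => [l ->|-> //].
  by have := fg l; rewrite !ffunE.
rewrite -cardsX -(card_imset _ h_inj); apply/subset_leq_card/fintype.subsetP.
move=> _ /imsetP[f /ordered_cliquesP Hf ->].
rewrite finset.in_setX; apply/andP; split; last by rewrite inE; apply: Hf.
by apply/ordered_cliquesP => i j ij; rewrite !ffunE; apply: Hf; rewrite !(inj_eq lift_inj).
Qed.

Lemma sum_card_nbhd : \sum_v #|[set w | e v w]| = #|ordered_edges|.
Proof.
rewrite -sum1_card (partition_big (fun p : T * T => p.1) predT) //=.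
apply: eq_bigr => v _; rewrite -sum1_card (reindex_onto (fun w => (v, w)) snd) /=.
  by apply: eq_bigl => w; rewrite !inE /= !eqxx !andbT.
by case=> a b /andP[_ /eqP /= ->].
Qed.

(** An ordered triangle at [v] is determined by its other two vertices. Both lie in the
    neighbourhood of [v], which gives the first bound, and they form an ordered edge, which gives
    the second. *)
Lemma card_triangles_at v :
  let t := #|[set f in ordered_cliques 3 | f ord0 == v]| in
  t <= #|[set w | e v w]| ^ 2 /\ t <= #|ordered_edges|.
Proof.
pose h (f : {ffun 'I_3 -> T}) := (f (lift ord0 ord0), f (lift ord0 (lift ord0 ord0))).
set S := [set f in _ | _]; move=> t.
have h_inj : {in S &, injective h}.
  move=> f g; rewrite !finset.in_set => /andP[_ /eqP f0] /andP[_ /eqP g0] [f1 f2].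
  apply/ffunP => i; case: (unliftP ord0 i) => [j ->|->]; last by rewrite f0 g0.
  case: (unliftP ord0 j) => [l ->|-> //].
  by have -> : l = ord0 by apply/val_inj; case: l => [[]].
rewrite /t -(card_in_imset h_inj) -mulnn -cardsX.
split; apply/subset_leq_card/fintype.subsetP => p /imsetP[f];
  rewrite finset.in_set => /andP[/ordered_cliquesP Hf /eqP f0] -> /=.
  by rewrite finset.in_setX !inE /= -f0 !Hf.
by rewrite inE /= Hf.
Qed.

Variable R : realType.

(* Two more vertices cost at most a factor [M = #|ordered_edges|]; the base case
   of triangles rests on [min (d^2) M <= d * sqrt M], the left-hand side bounding
   the number of ordered triangles at a vertex of degree [d]. *)
Lemma card_ordered_cliques_le k : (2 <= k) ->
  (#|ordered_cliques k|%:R <= Num.sqrt (#|ordered_edges|%:R : R) ^+ k)%R.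
Proof.
set M := #|ordered_edges|.
have MR : (Num.sqrt (M%:R : R) ^+ 2 = M%:R)%R by rewrite sqr_sqrtr.
suff H m : (#|ordered_cliques m.+2|%:R <= Num.sqrt (M%:R : R) ^+ m.+2)%R /\
           (#|ordered_cliques m.+3|%:R <= Num.sqrt (M%:R : R) ^+ m.+3)%R.
  by case: k => [|[|k]] // _; have [] := H k.
have step j : (#|ordered_cliques j|%:R <= Num.sqrt (M%:R : R) ^+ j)%R ->
    (#|ordered_cliques j.+2|%:R <= Num.sqrt (M%:R : R) ^+ j.+2)%R.
  move=> Hj; apply: (@le_trans _ _ (#|ordered_cliques j| * M)%:R).
    by rewrite ler_nat card_ordered_cliquesSS.
  by rewrite -addn2 exprD MR natrM ler_wpM2r.
elim: m => [|m [IH1 IH2]]; last by split=> //; apply: step.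
split; first by apply: step; rewrite expr0 lern1 card_ordered_cliques0.
rewrite -sum1_card (partition_big (fun f : {ffun 'I_3 -> T} => f ord0) predT) //=.
rewrite natr_sum exprS MR [leRHS]mulrC.
rewrite {1}/M -sum_card_nbhd natr_sum mulr_suml; apply: ler_sum => v _.
have -> : \sum_(f in ordered_cliques 3 | f ord0 == v) 1 =
          #|[set f in ordered_cliques 3 | f ord0 == v]|.
  by rewrite -sum1_card; apply: eq_bigl => f; rewrite !inE.
have [/= t1 t2] := card_triangles_at v; set t := #|_| in t1 t2 *.
rewrite -(@ler_pXn2r _ 2) ?nnegrE ?mulr_ge0 ?sqrtr_ge0 //.
by rewrite exprMn MR -!natrX -natrM ler_nat -mulnn leq_mul.
Qed.

End Cliques.

(** * Embeddings, copies and edge counts of coloured graphs *)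

Section Embeddings.
Local Open Scope nat_scope.

(** The diagonal has to be excluded, since the colour [cf u u] is arbitrary. *)
Definition col_edge (G : col3) (c : color) : rel 'I_(cn G) :=
  fun u v => (u != v) && (cf u v == c).

Definition embeddings (F G : col3) : {set {ffun 'I_(cn F) -> 'I_(cn G)}} :=
  [set pi : {ffun 'I_(cn F) -> 'I_(cn G)} | injectiveb pi &&
     [forall u, forall v, (u != v) ==> (cf u v == cf (pi u) (pi v))]].

Lemma embeddingsP F G (pi : {ffun 'I_(cn F) -> 'I_(cn G)}) :
  reflect (injective pi /\ forall u v, u != v -> cf u v = cf (pi u) (pi v))
          (pi \in embeddings F G).
Proof.
rewrite inE; apply: (iffP andP) => -[/injectiveP pi_inj pi_col]; split=> //.
  by move=> u v uv; have /forallP/(_ v)/implyP/(_ uv)/eqP := forallP pi_col u.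
by apply/forallP => u; apply/forallP => v; apply/implyP => uv; rewrite pi_col.
Qed.

(** The set comprehensions in [ecount] and [N3] are classical sets, with membership through
    [asbool]; here and in [N3E] they are replaced by finite sets. *)
Lemma ecountE (G : col3) (c : color) :
  ecount G c = #|[set p : 'I_(cn G) * 'I_(cn G) | (p.1 < p.2) && (cf p.1 p.2 == c)]|.
Proof. by apply: eq_card => p; rewrite inE; exact: asboolb. Qed.

Lemma N3E (F G : col3) : N3 F G = #|[set X : {set 'I_(cn G)} | is_copy F X]|.
Proof. by apply: eq_card => X; rewrite inE; exact: asboolb. Qed.

Lemma is_copyP (F G : col3) (X : {set 'I_(cn G)}) :
  reflect (exists2 pi, pi \in embeddings F G & X = pi @: [set: 'I_(cn F)]) (is_copy F X).
Proof.
have imT (pi : {ffun 'I_(cn F) -> 'I_(cn G)}) :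
    pi @: (classical_sets.setT : set 'I_(cn F)) = pi @: [set: 'I_(cn F)].
  by apply/setP => x; apply/imsetP/imsetP => -[u _ ->]; exists u => //; rewrite inE.
apply: (iffP andP) => [[_ /existsP[pi /and3P[pi_inj /eqP <- pi_col]]]|[pi piE ->]].
  by exists pi; rewrite ?imT // inE pi_inj.
move: (piE) => /embeddingsP[pi_inj _]; rewrite card_imset // cardsT card_ord.
split=> //; apply/existsP; exists pi; move: piE; rewrite inE imT eqxx /=.
by case/andP => -> ->.
Qed.

Lemma cards_pairs_swap (T : finType) (P Q : pred (T * T)) :
  (forall x y, P (x, y) = Q (y, x)) -> #|[set p | P p]| = #|[set p | Q p]|.
Proof.
move=> PQ; pose sw (p : T * T) := (p.2, p.1).
have sw_inj : injective sw by case=> a b [c d] [-> ->].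
rewrite -(card_imset _ sw_inj); apply: eq_card => -[x y].
rewrite inE -PQ; apply/imsetP/idP => [[[a b]]|Pxy]; first by rewrite inE => ? [-> ->].
by exists (y, x) => //; rewrite inE.
Qed.

Lemma card_col_edges (G : col3) (c : color) :
  #|ordered_edges (@col_edge G c)| = 2 * ecount G c.
Proof.
rewrite /ordered_edges -(cardsID [set p : 'I_(cn G) * 'I_(cn G) | p.1 < p.2]).
rewrite ecountE mul2n -addnn; congr (_ + _).
  apply: eq_card => -[u v]; rewrite !inE /= /col_edge andbC.
  by rewrite -val_eqE /=; case: ltngtP.
rewrite [RHS](@cards_pairs_swap 'I_(cn G) _ (fun p => (p.2 < p.1) && (cf p.1 p.2 == c))).
  apply: eq_card => -[u v]; rewrite !inE /= /col_edge -val_eqE /=.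
  by case: ltngtP.
by move=> u v /=; rewrite cf_sym.
Qed.

Lemma card_offdiag (T : finType) (A : {set T}) :
  #|[set p : T * T | [&& p.1 != p.2, p.1 \in A & p.2 \in A]]| = #|A| ^_ 2.
Proof.
rewrite -sum1_card (partition_big (fun p : T * T => p.1) (mem A)) /=; last first.
  by case=> x y; rewrite inE => /and3P[].
rewrite (eq_bigr (fun=> #|A|.-1)) => [|x xA].
  by rewrite sum_nat_const ffactnS ffactn1.
rewrite (reindex_onto (fun y => (x, y)) snd) /=; last by case=> a b /andP[_ /eqP /= ->].
rewrite (cardsD1 x A) xA /= -sum1_card; apply: eq_bigl => y.
by rewrite !inE /= !eqxx !andbT xA eq_sym.
Qed.

Lemma ecount_sum (G : col3) :
  ecount G blue + ecount G green + ecount G red = 'C(cn G, 2).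
Proof.
(* Once doubled, both sides count ordered pairs of distinct vertices, on the left sorted by
   colour. *)
apply/eqP; rewrite -(eqn_pmul2l (isT : 0 < 2)) !mulnDr -!card_col_edges.
rewrite [X in _ == X]mulnC -[X in _ == _ * X]/(2`!) bin_ffact -[X in X ^_ 2](card_ord (cn G)).
rewrite -cardsT -card_offdiag; apply/eqP; rewrite -[RHS]sum1_card.
rewrite [RHS](partition_big (fun p : 'I_(cn G) * 'I_(cn G) => cf p.1 p.2) predT) //=.
rewrite !big_ord_recl big_ord0 addn0 -addnA; congr (_ + (_ + _));
  rewrite -sum1_card; apply: eq_bigl => -[u v]; rewrite !inE /= andbT;
  congr (_ && (_ == _)); exact: val_inj.
Qed.

(** These are automorphisms of [Kst s t], and the source of the factor [s! t!] in the count of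
    copies. *)
Definition block_fun s t (p : {perm 'I_s} * {perm 'I_t}) (u : 'I_(s + t)) : 'I_(s + t) :=
  match fintype.split u with inl i => lshift t (p.1 i) | inr j => rshift s (p.2 j) end.

Lemma block_fun_lshift s t p i : @block_fun s t p (lshift t i) = lshift t (p.1 i).
Proof. by rewrite /block_fun -[lshift t i]/(unsplit (inl i)) unsplitK. Qed.

Lemma block_fun_rshift s t p j : @block_fun s t p (rshift s j) = rshift s (p.2 j).
Proof. by rewrite /block_fun -[rshift s j]/(unsplit (inr j)) unsplitK. Qed.

Lemma block_fun_inj s t p : injective (@block_fun s t p).
Proof.
move=> u v; case: (split_ordP u) => i ->; case: (split_ordP v) => j ->;
  rewrite ?block_fun_lshift ?block_fun_rshift => /eqP; rewrite eq_shift // => /eqP.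
- by move=> /perm_inj ->.
- by move=> /perm_inj ->.
Qed.

(** [Kcol] only looks at the side of [s] on which its arguments lie, so colours are preserved as
    soon as sides are. *)
Lemma block_fun_ltn s t p u : (@block_fun s t p u < s) = (u < s).
Proof.
case: (split_ordP u) => i ->; rewrite ?block_fun_lshift ?block_fun_rshift /=.
  by rewrite !ltn_ord.
by rewrite ![s + _ < s]ltnNge !leq_addr.
Qed.

Lemma Kcol_block_fun s t p u v :
  Kcol s t (block_fun p u) (block_fun p v) = Kcol s t u v.
Proof. by rewrite /Kcol !(leqNgt s) !block_fun_ltn. Qed.

(** Sort the embeddings by their image. Over a copy, composing one embedding [pi0] with the maps
    [block_fun p] yields [s! t!] distinct embeddings with the same image. *)
Lemma N3_Kst_le s t (G : col3) :
  N3 (Kst s t) G * (s`! * t`!) <= #|embeddings (Kst s t) G|.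
Proof.
rewrite -[X in _ <= X]sum1_card (partition_big
  (fun pi : {ffun 'I_(cn (Kst s t)) -> 'I_(cn G)} => pi @: [set: _]) predT) //=.
rewrite N3E -sum_nat_const [X in _ <= X](bigID (mem [set X | is_copy (Kst s t) X])) /=.
apply: leq_trans (leq_addr _ _); apply: leq_sum => X; rewrite inE.
case/is_copyP => pi0 /embeddingsP[pi0_inj pi0_col] ->.
pose h p : {ffun 'I_(s + t) -> 'I_(cn G)} := [ffun u => pi0 (block_fun p u)].
have h_inj : injective h.
  move=> [p q] [p' q'] /ffunP hh; congr (_, _); apply/permP => i.
    have := hh (lshift t i); rewrite !ffunE => /pi0_inj; rewrite !block_fun_lshift.
    by move/lshift_inj.
  have := hh (rshift s i); rewrite !ffunE => /pi0_inj; rewrite !block_fun_rshift.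
  by move/rshift_inj.
rewrite -(card_Sn s) -(card_Sn t) -card_prod -cardsT -(card_imset _ h_inj) -sum1_card.
rewrite [X in X <= _]big_mkcond [X in _ <= X]big_mkcond; apply: leq_sum => pi _.
case: imsetP => // -[p _ ->]; rewrite ifT //; apply/andP; split.
  apply/(@embeddingsP (Kst s t) G); split=> [u v|u v uv].
    by rewrite !ffunE => /pi0_inj /block_fun_inj.
  by rewrite !ffunE -pi0_col ?(inj_eq (@block_fun_inj _ _ p)) //= Kcol_block_fun.
rewrite eqEcard; apply/andP; split; last first.
  rewrite !card_imset //; move=> u v; rewrite !ffunE => /pi0_inj; exact: block_fun_inj.
apply/fintype.subsetP => x /imsetP[u _ ->]; rewrite !ffunE; exact: imset_f.
Qed.

(** An embedding is determined by its restrictions to the two sides, which are cliques of the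
    respective colours; the red edges across are forgotten. *)
Lemma card_embeddings_Kst_le s t (G : col3) :
  #|embeddings (Kst s t) G| <=
  #|ordered_cliques (@col_edge G blue) s| * #|ordered_cliques (@col_edge G green) t|.
Proof.
pose h (pi : {ffun 'I_(s + t) -> 'I_(cn G)}) :=
  ([ffun i => pi (lshift t i)] : {ffun 'I_s -> _},
   [ffun j => pi (rshift s j)] : {ffun 'I_t -> _}).
have h_inj : injective h.
  move=> f g [/ffunP fg1 /ffunP fg2]; apply/ffunP => u.
  case: (split_ordP u) => i ->; first by have := fg1 i; rewrite !ffunE.
  by have := fg2 i; rewrite !ffunE.
rewrite -cardsX -(card_imset _ h_inj); apply/subset_leq_card/fintype.subsetP.
move=> _ /imsetP[f /embeddingsP[f_inj f_col] ->].
rewrite finset.in_setX; apply/andP; split; apply/ordered_cliquesP => i j ij;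
  rewrite /col_edge !ffunE (inj_eq f_inj) eq_shift ij /= -f_col ?eq_shift // /Kst /= /Kcol /=.
  by rewrite !ltn_ord.
by rewrite !leq_addr ltnNge leq_addr.
Qed.

(* Two embeddings with the same tuple of unordered edges [{pi i, pi (s + i)}]
   coincide: as soon as [s >= 2], reversing some of these edges would turn a
   blue edge [pi i, pi j] into a red or a green one. *)
Lemma card_embeddings_Kss_le s (G : col3) : 2 <= s ->
  #|embeddings (Kst s s) G| <= ecount G red ^ s.
Proof.
move=> s_ge2.
pose ed (x y : 'I_(cn G)) := if x < y then (x, y) else (y, x).
have edP x y x' y' : ed x y = ed x' y' -> x' = x \/ x' = y.
  by rewrite /ed; case: ifP; case: ifP => _ _ [-> ->]; auto.
have edP2 x y y' : ed x y = ed x y' -> y = y'.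
  by rewrite /ed; case: ifP; case: ifP => _ _ [] // -> ->.
pose h (pi : {ffun 'I_(s + s) -> 'I_(cn G)}) :=
  [ffun i : 'I_s => ed (pi (lshift s i)) (pi (rshift s i))].
pose E := [set p : 'I_(cn G) * 'I_(cn G) | (p.1 < p.2) && (cf p.1 p.2 == red)].
have colE : forall f, f \in embeddings (Kst s s) G -> forall i j : 'I_s, i != j ->
    [/\ cf (f (lshift s i)) (f (lshift s j)) = blue,
        cf (f (rshift s i)) (f (lshift s j)) = red &
        cf (f (rshift s i)) (f (rshift s j)) = green].
  move=> f /embeddingsP[f_inj f_col] i j ij; rewrite -!f_col ?eq_shift // /Kst /= /Kcol /=.
  by rewrite !ltn_ord !leq_addr /= [s + i < s]ltnNge leq_addr /= [s <= j]leqNgt ltn_ord.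
have h_inj : {in embeddings (Kst s s) G &, injective h}.
  move=> f g fE gE /ffunP hh.
  have fgl i : g (lshift s i) = f (lshift s i).
    have := hh i; rewrite !ffunE => /edP[// | gi].
    have [j ij] : exists j : 'I_s, i != j.
      have : 0 < #|[set~ i]| by rewrite cardsC1 card_ord -subn1 subn_gt0.
      by case/card_gt0P => j; rewrite !inE eq_sym => ij; exists j.
    have [_ red_ij green_ij] := colE f fE _ _ ij.
    have [blue_ij _ _] := colE g gE _ _ ij.
    have := hh j; rewrite !ffunE => /edP[] gj.
      by move: blue_ij; rewrite gi gj red_ij.
    by move: blue_ij; rewrite gi gj green_ij.
  apply/ffunP => u; case: (split_ordP u) => i ->; first by rewrite fgl.
  by have := hh i; rewrite !ffunE fgl => /edP2.
rewrite -(card_in_imset h_inj) ecountE -/E -[X in _ ^ X](card_ord s) -card_ffun_on.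
apply/subset_leq_card/fintype.subsetP => _ /imsetP[f /embeddingsP[f_inj f_col] ->].
apply/ffun_onP => i; rewrite ffunE /E inE.
have cred : cf (f (lshift s i)) (f (rshift s i)) = red.
  rewrite -f_col ?eq_shift // /Kst /= /Kcol /= ltn_ord /= [s + i < s]ltnNge leq_addr /=.
  by rewrite [s <= i]leqNgt ltn_ord.
have : f (lshift s i) != f (rshift s i) by rewrite (inj_eq f_inj) eq_shift.
rewrite /ed -val_eqE /=; case: (ltngtP (f (lshift s i)) (f (rshift s i))) => //= lt _;
  rewrite lt /= ?cred //.
by rewrite cf_sym cred.
Qed.

End Embeddings.

(** * The colouring built from a blue and a green clique *)

Section TwoCliques.
Local Open Scope nat_scope.
Variables (n : nat) (A B : {set 'I_n}) (c0 : color).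

(** The colour [c0] goes to the edges with an end outside [A :|: B]; it is red in the first regime
    of the theorem and green in the second. *)
Definition two_cliques_col (u v : 'I_n) : color :=
  if (u \in A) && (v \in A) then blue
  else if (u \in B) && (v \in B) then green
  else if (u \in A :|: B) && (v \in A :|: B) then red
  else c0.

Lemma two_cliques_col_sym u v : two_cliques_col u v = two_cliques_col v u.
Proof.
by rewrite /two_cliques_col (andbC (u \in A)) (andbC (u \in B)) (andbC (u \in A :|: B)).
Qed.

Definition two_cliques : col3 := Col3 two_cliques_col_sym.

Hypothesis AB : [disjoint A & B].

Lemma ecount_two_cliques_blue : c0 != blue -> 2 * ecount two_cliques blue = #|A| ^_ 2.
Proof.
move=> c0b; rewrite -card_col_edges -card_offdiag; apply: eq_card => -[u v].
rewrite !inE /= /col_edge /= /two_cliques_col; case: eqP => //= _.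
by case: ifP => // _; case: ifP => // _; case: ifP => // _; apply/negbTE.
Qed.

Lemma ecount_two_cliques_green : c0 = red -> 2 * ecount two_cliques green = #|B| ^_ 2.
Proof.
move=> c0r; rewrite -card_col_edges -card_offdiag; apply: eq_card => -[u v].
rewrite !inE /= /col_edge /= /two_cliques_col c0r; case: eqP => //= _.
case: ifP => [/andP[uA _]|_]; first by rewrite (disjointFr AB uA).
by case: ifP => // _; case: ifP.
Qed.

Lemma ecount_two_cliques_red : c0 = green -> ecount two_cliques red = #|A| * #|B|.
Proof.
move=> c0g; apply/eqP; rewrite -(eqn_pmul2l (isT : 0 < 2)) -card_col_edges mul2n -addnn.
rewrite -{1}cardsX mulnC -cardsX; apply/eqP.
have BA := AB; rewrite disjoint_sym in BA.
have -> : ordered_edges (@col_edge two_cliques red) = finset.setX A B :|: finset.setX B A.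
  apply/setP => -[u v]; rewrite !inE /= /col_edge /= /two_cliques_col c0g !finset.in_setU.
  case uA: (u \in A); case vA: (v \in A); rewrite /= ?(disjointFr AB uA) ?(disjointFr AB vA) /=.
  - by rewrite andbF.
  - case vB: (v \in B); rewrite ?andbF //= andbT; apply/eqP => uv; by rewrite -uv uA in vA.
  - case uB: (u \in B); rewrite ?andbF //= andbT; apply/eqP => uv; by rewrite uv vA in uA.
  - by case: (u \in B); case: (v \in B); rewrite ?andbF.
rewrite cardsU (_ : finset.setX A B :&: finset.setX B A = finset.set0) ?cards0 ?subn0 //.
apply/setP => -[u v]; rewrite !inE; case uA: (u \in A) => //=.
by rewrite (disjointFr AB uA) andbF.
Qed.

(** An [s]-subset of [A] and a [t]-subset of [B] together span a copy. Intersecting the union with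
    [A] and with [B] recovers both, so distinct pairs give distinct copies. *)
Lemma N3_two_cliques_ge s t : 0 < s ->
  'C(#|A|, s) * 'C(#|B|, t) <= N3 (Kst s t) two_cliques.
Proof.
move=> s_gt0; rewrite -!cards_draws -cardsX N3E.
set D := finset.setX _ _.
have DP p : p \in D -> [/\ p.1 \subset A, p.2 \subset B, #|p.1| = s & #|p.2| = t].
  by case: p => a b; rewrite !inE /= => /andP[/andP[-> /eqP ->] /andP[-> /eqP ->]].
pose h (p : {set 'I_n} * {set 'I_n}) := p.1 :|: p.2.
have hA p : p \in D -> h p :&: A = p.1 /\ h p :&: B = p.2.
  case/DP=> /finset.setIidPl pA /finset.setIidPl pB _ _; rewrite /h !finset.setIUl pA pB.
  by rewrite -pA -pB -!finset.setIA (finset.setIC B) (disjoint_setI0 AB) !finset.setI0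
    finset.setU0 finset.set0U.
have h_inj : {in D &, injective h}.
  move=> [p q] [p' q'] pD pD' hh.
  have [/= e1 e2] := hA _ pD; have [/= e1' e2'] := hA _ pD'.
  by rewrite hh in e1 e2; congr (_, _); [rewrite -e1 e1'|rewrite -e2 e2'].
rewrite -(card_in_imset h_inj); apply/subset_leq_card/fintype.subsetP.
move=> _ /imsetP[[P Q] /DP[/= PA QB Ps Qt] ->]; rewrite inE.
(* Listing [P] before [Q] sends the first [s] vertices of [Kst s t] into [A] and the last [t] into
   [B]. *)
pose L := enum P ++ enum Q.
have sL : size L = s + t by rewrite size_cat -!cardE Ps Qt.
(* [0 < s] supplies a default vertex for [nth]. *)
have /card_gt0P[x0 _] : 0 < #|P| by rewrite Ps.
pose pi := [ffun u : 'I_(s + t) => nth x0 L u].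
have uL : uniq L.
  rewrite cat_uniq !enum_uniq andbT /=; apply/hasPn => x; rewrite !mem_enum => xQ.
  apply/negP => xP; have := fintype.subsetP QB _ xQ.
  by rewrite (disjointFr AB (fintype.subsetP PA _ xP)).
have piL (i : 'I_s) : pi (lshift t i) \in A.
  apply: (fintype.subsetP PA).
  by rewrite ffunE nth_cat /= -cardE Ps ltn_ord -mem_enum mem_nth // -cardE Ps.
have piR (i : 'I_t) : pi (rshift s i) \in B.
  apply: (fintype.subsetP QB).
  by rewrite ffunE nth_cat /= -cardE Ps ltnNge leq_addr /= addKn -mem_enum mem_nth // -cardE Qt.
have pi_inj : injective pi.
  move=> u v; rewrite !ffunE => /eqP; rewrite nth_uniq ?sL // => /eqP; exact: val_inj.
apply/(@is_copyP (Kst s t) two_cliques); exists pi.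
  apply/(@embeddingsP (Kst s t) two_cliques); split=> // u v _.
  rewrite /= /Kcol /two_cliques_col !finset.in_setU.
  case: (split_ordP u) => i ->; case: (split_ordP v) => j ->;
    rewrite ?piL ?piR ?(disjointFr AB (piL _)) ?(disjointFl AB (piR _)) /=;
    by rewrite ?ltn_ord ?leq_addr //= ?[s + _ < s]ltnNge ?leq_addr //= ?[s <= _]leqNgt ?ltn_ord.
rewrite /h; apply/setP => x.
rewrite finset.in_setU /= -[x \in P]mem_enum -[x \in Q]mem_enum -mem_cat -/L.
apply/idP/imsetP => [xL|[u _ ->]].
  have iL : index x L < s + t by rewrite -sL index_mem.
  by exists (Ordinal iL); rewrite ?inE // ffunE nth_index.
by rewrite ffunE mem_nth // sL.
Qed.

End TwoCliques.

(** * Disjoint vertex sets of prescribed sizes *)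

Definition ord_interval n lo k : {set 'I_n} := [set i : 'I_n | (lo <= i < lo + k)%N].

Lemma card_ord_interval n lo k : (lo + k <= n)%N ->
  #|ord_interval n lo k| = k.
Proof.
move=> lok; have lt_n (i : 'I_k) : (lo + i < n)%N.
  by apply: leq_trans lok; rewrite ltn_add2l.
pose h (i : 'I_k) : 'I_n := Ordinal (lt_n i).
have h_inj : injective h by move=> i j [] /addnI; exact: val_inj.
rewrite -[RHS]card_ord -cardsT -(card_imset _ h_inj); apply: eq_card => x.
rewrite inE; apply/idP/imsetP => [/andP[lox xk]|[i _ ->] /=].
  have xlo : (x - lo < k)%N by rewrite ltn_subLR.
  by exists (Ordinal xlo) => //; apply: val_inj; rewrite /= subnKC.
by rewrite leq_addr ltn_add2l ltn_ord.
Qed.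

Lemma disjoint_ord_interval n a b : [disjoint ord_interval n 0 a & ord_interval n a b].
Proof.
rewrite disjoint_subset; apply/fintype.subsetP => i; rewrite !inE /= => ia.
by rewrite leqNgt ia.
Qed.

(** * Limits of falling factorials over powers *)

Section Limits.
Local Open Scope classical_set_scope.
Variable R : realType.
Implicit Types (m a b : nat -> nat).

Lemma cvg_expr (u : nat -> R) (L : R) k :
  u @ \oo --> L -> u n ^+ k @[n --> \oo] --> L ^+ k.
Proof. move=> uL; exact: (cvg_comp u (fun x : R => x ^+ k) uL (@exprn_continuous R k L)). Qed.

Lemma cvg_ffact_ratio m a (alpha : R) k :
  (m n)%:R @[n --> \oo] --> (+oo : set_system R) ->
  (a n)%:R / (m n)%:R @[n --> \oo] --> alpha ->
  (a n ^_ k)%:R / (m n)%:R ^+ k @[n --> \oo] --> alpha ^+ k.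
Proof.
move=> m_oo a_alpha; elim: k => [|k IH].
  under eq_fun do rewrite ffactn0 expr0 divr1.
  exact: cvg_cst.
under eq_fun do rewrite ffactnSr natrM exprSr invfM mulrACA.
rewrite exprSr; apply: cvgM => //.
have m_inv : ((m n)%:R : R)^-1 @[n --> \oo] --> (0 : R).
  apply/gtr0_cvgV0 => //; have /cvgryPgt /(_ 0) := m_oo; exact.
(* The new factor is [(a n - k) / m n] with truncated subtraction. Truncation can only increase it,
   so the lower bound holds even when [a n < k]. *)
apply: (@squeeze_cvgr _ _ _ _ (fun n => (a n)%:R / (m n)%:R - k%:R * (m n)%:R^-1)
                              (fun n => (a n)%:R / (m n)%:R)) => //.
  near=> n; rewrite -mulrBl !ler_wpM2r ?invr_ge0 //.
  - by rewrite ler_nat leq_subr.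
  - by rewrite lerBlDr -natrD ler_nat addnC -leq_subLR.
rewrite -[X in _ --> X]subr0 -[X in _ - X](mulr0 k%:R); apply: cvgB => //.
exact: cvgMr.
Unshelve. all: by end_near.
Qed.

Lemma cvg_self_ratio m : (m n)%:R @[n --> \oo] --> (+oo : set_system R) ->
  (m n)%:R / (m n)%:R @[n --> \oo] --> (1 : R).
Proof.
move=> m_oo; apply: cvg_near_cst.
have /cvgryPgt /(_ 0) m_gt0 := m_oo; near=> n; apply: divff.
by rewrite gt_eqF //; near: n.
Unshelve. all: by end_near.
Qed.

(** * Normalised counts of copies and the value of [I3] *)

(** The proportion of injections among all maps from [k] points to [n] points: the price, negligible
    in the limit, of normalising by powers instead of binomials. *)
Definition ffact_defect (n k : nat) : R := (n ^_ k)%:R / n%:R ^+ k.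

Lemma cvg_ffact_defect m k : (m n)%:R @[n --> \oo] --> (+oo : set_system R) ->
  ffact_defect (m n) k @[n --> \oo] --> (1 : R).
Proof.
move=> m_oo; have := cvg_ffact_ratio (k := k) m_oo (cvg_self_ratio m_oo).
by rewrite expr1n.
Qed.

Lemma ffact_defect_ge0 n k : 0 <= ffact_defect n k.
Proof. by rewrite /ffact_defect divr_ge0 // exprn_ge0. Qed.

(* [s! t! N3 / n^(s+t)]: the number of embeddings of [Kst s t] normalised by the
   number of all maps. *)
Definition hom_density (s t : nat) (G : col3) : R :=
  (N3 (Kst s t) G * (s`! * t`!))%:R / (cn G)%:R ^+ (s + t).

(** The binomial of the theorem appears here, as the quotient of [(s + t)!] by [s! t!]. *)
Lemma rho3E s t (G : col3) : (0 < cn G)%N ->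
  rho3 R (Kst s t) G = hom_density s t G / ffact_defect (cn G) (s + t) * 'C(s + t, s)%:R.
Proof.
move=> n_gt0; rewrite /rho3 /hom_density /ffact_defect -bin_ffact.
have nz : (cn G)%:R ^+ (s + t) != 0 :> R by rewrite expf_neq0 // pnatr_eq0 -lt0n.
have := bin_fact (leq_addr t s); rewrite addKn => <-.
rewrite /= !natrM invf_div !mulrA -!mulrA (mulKf nz).
have sz : (s`!)%:R != 0 :> R by rewrite pnatr_eq0 -lt0n fact_gt0.
have tz : (t`!)%:R != 0 :> R by rewrite pnatr_eq0 -lt0n fact_gt0.
have cz : 'C(s + t, s)%:R != 0 :> R by rewrite pnatr_eq0 -lt0n bin_gt0 leq_addr.
(* With fewer than [s + t] vertices this binomial is zero, and both sides vanish because the inverse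
   of 0 is 0. *)
rewrite !invfM; case: (eqVneq ('C(cn G, s + t)%:R : R) 0) => [->|bz].
  by rewrite invr0 !(mul0r, mulr0).
by field; rewrite sz tz cz bz.
Qed.

Lemma rho3_hom_density_le s t (G : col3) (u : R) : (0 < cn G)%N ->
  hom_density s t G <= u ->
  rho3 R (Kst s t) G <= u / ffact_defect (cn G) (s + t) * 'C(s + t, s)%:R.
Proof.
move=> n_gt0 le_u; rewrite rho3E // !ler_wpM2r // invr_ge0; exact: ffact_defect_ge0.
Qed.

Lemma rho3_hom_density_ge s t (G : col3) (u : R) : (0 < cn G)%N ->
  u <= hom_density s t G ->
  u / ffact_defect (cn G) (s + t) * 'C(s + t, s)%:R <= rho3 R (Kst s t) G.
Proof.
move=> n_gt0 le_u; rewrite rho3E // !ler_wpM2r // invr_ge0; exact: ffact_defect_ge0.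
Qed.

Lemma cvg_div_ffact_defect m k (u : nat -> R) (L C : R) :
  (m n)%:R @[n --> \oo] --> (+oo : set_system R) -> u @ \oo --> L ->
  u n / ffact_defect (m n) k * C @[n --> \oo] --> L * C.
Proof.
move=> m_oo uL; apply: cvgMl; rewrite -[X in _ --> X]divr1; apply: cvgM => //.
by apply: cvgV; [exact: oner_neq0 | exact: cvg_ffact_defect].
Qed.

(** The supremum is a maximum: [U] caps every sequence with the prescribed edge densities, while
    [Gs] is squeezed between [l] and [U], which share the limit [L]. *)
Lemma I3_eq s t (xb xg L : R) (U : col3 -> R) (Gs : nat -> col3) (l : nat -> R) :
  (forall G, (2 <= cn G)%N -> hom_density s t G <= U G) ->
  (forall Hs : nat -> col3,
     rho R (Hs n) blue @[n --> \oo] --> xb -> rho R (Hs n) green @[n --> \oo] --> xg ->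
     U (Hs n) @[n --> \oo] --> L) ->
  (cn (Gs n))%:R @[n --> \oo] --> (+oo : set_system R) ->
  rho R (Gs n) blue @[n --> \oo] --> xb -> rho R (Gs n) green @[n --> \oo] --> xg ->
  (forall n, l n <= hom_density s t (Gs n)) -> l @ \oo --> L ->
  I3 (Kst s t) xb xg = L * 'C(s + t, s)%:R.
Proof.
move=> leU cvgU Gs_oo Gs_b Gs_g lel cvgl.
have big Hs : (cn (Hs n))%:R @[n --> \oo] --> (+oo : set_system R) ->
    \forall n \near \oo, (2 <= cn (Hs n))%N.
  move=> Hs_oo; have /cvgryPge /(_ 2) := Hs_oo; apply: filterS => n.
  by rewrite ler_nat.
rewrite /I3; set S := (X in sup X).
have S_ub : ubound S (L * 'C(s + t, s)%:R).
  move=> y [Hs [Hs_oo [Hs_b [Hs_g Hs_y]]]].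
  apply: (ler_cvg_to Hs_y (cvg_div_ffact_defect (s + t) (C := 'C(s + t, s)%:R)
    Hs_oo (cvgU _ Hs_b Hs_g))).
  near=> n; have n2 : (2 <= cn (Hs n))%N by near: n; exact: big.
  by apply: rho3_hom_density_le; [exact: ltnW | exact: leU].
have S_in : S (L * 'C(s + t, s)%:R).
  exists Gs; split=> //; split=> //; split=> //.
  apply: squeeze_cvgr (cvg_div_ffact_defect (s + t) (C := 'C(s + t, s)%:R) Gs_oo cvgl)
                      (cvg_div_ffact_defect (s + t) (C := 'C(s + t, s)%:R)
                         Gs_oo (cvgU _ Gs_b Gs_g)).
  near=> n; have n2 : (2 <= cn (Gs n))%N by near: n; exact: big.
  by rewrite rho3_hom_density_ge ?rho3_hom_density_le ?leU // ltnW.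
apply/le_anti/andP; split; first by apply: ge_sup => //; eexists; exact: S_in.
by apply: ub_le_sup => //; eexists; exact: S_ub.
Unshelve. all: by end_near.
Qed.

(** * Edge densities and the two upper bounds *)

Lemma natr_bin2_le n : 'C(n, 2)%:R * 2 <= n%:R ^+ 2 :> R.
Proof.
rewrite -natrX -natrM ler_nat -[X in (_ * X <= _)%N]/(2`!) bin_ffact ffactnS ffactn1.
by rewrite -mulnn leq_mul // leq_pred.
Qed.

Lemma natr_ecount (G : col3) c : (2 <= cn G)%N ->
  (ecount G c)%:R = rho R G c * 'C(cn G, 2)%:R.
Proof. by move=> n2; rewrite /rho divfK // pnatr_eq0 -lt0n bin_gt0. Qed.

Lemma rho_sum (G : col3) : (2 <= cn G)%N ->
  rho R G blue + rho R G green + rho R G red = 1.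
Proof.
move=> n2; rewrite /rho -!mulrDl -!natrD ecount_sum divff //.
by rewrite pnatr_eq0 -lt0n bin_gt0.
Qed.

Lemma rho_ge0 (G : col3) c : 0 <= rho R G c.
Proof. by rewrite /rho divr_ge0. Qed.

Lemma hom_density_le_cliques s t (G : col3) : (2 <= s)%N -> (2 <= t)%N -> (2 <= cn G)%N ->
  hom_density s t G <= Num.sqrt (rho R G blue) ^+ s * Num.sqrt (rho R G green) ^+ t.
Proof.
move=> s2 t2 n2.
have n_gt0 : 0 < (cn G)%:R :> R by rewrite ltr0n ltnW.
rewrite /hom_density ler_pdivrMr ?exprn_gt0 // exprD mulrACA -!exprMn.
apply: (@le_trans _ _ (#|ordered_cliques (@col_edge G blue) s| *
                       #|ordered_cliques (@col_edge G green) t|)%:R).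
  by rewrite ler_nat (leq_trans (N3_Kst_le _ _ _)) // card_embeddings_Kst_le.
(* The number of ordered edges of colour [c] is [2 * rho * 'C(n, 2)], hence at most
   [rho * n ^ 2]. *)
have cl c k : (2 <= k)%N -> (#|ordered_cliques (@col_edge G c) k|)%:R <=
    (Num.sqrt (rho R G c) * (cn G)%:R) ^+ k.
  move=> k2; apply: le_trans (card_ordered_cliques_le _ R k2) _.
  rewrite lerXn2r ?nnegrE ?mulr_ge0 ?sqrtr_ge0 //.
  rewrite -[X in _ * X](ger0_norm (ltW n_gt0)) -sqrtr_sqr -sqrtrM ?rho_ge0 //.
  rewrite ler_wsqrtr // card_col_edges natrM natr_ecount // mulrCA.
  by rewrite ler_wpM2l ?rho_ge0 // mulrC natr_bin2_le.
by rewrite natrM ler_pM // cl.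
Qed.

(** The red density is written through blue and green, the two colours whose limits are
    prescribed. *)
Lemma hom_density_le_red s (G : col3) : (2 <= s)%N -> (2 <= cn G)%N ->
  hom_density s s G <= ((1 - rho R G blue - rho R G green) / 2) ^+ s.
Proof.
move=> s2 n2.
have n_gt0 : 0 < (cn G)%:R :> R by rewrite ltr0n ltnW.
have -> : 1 - rho R G blue - rho R G green = rho R G red by rewrite -(rho_sum n2); ring.
rewrite /hom_density ler_pdivrMr ?exprn_gt0 // addnn -mul2n exprM -exprMn.
apply: (@le_trans _ _ (ecount G red ^ s)%:R).
  by rewrite ler_nat (leq_trans (N3_Kst_le _ _ _)) // card_embeddings_Kss_le.
rewrite natrX lerXn2r ?nnegrE ?mulr_ge0 ?divr_ge0 ?rho_ge0 ?exprn_ge0 //.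
rewrite natr_ecount // -[leRHS]mulrA ler_wpM2l ?rho_ge0 // ler_pdivlMl //.
by rewrite mulrC natr_bin2_le.
Qed.

(** The trailing [* 1] matches the shape of [cvg_div_ffact_defect], taken with [C := 1] in
    [cvg_rho]. *)
Lemma rho_ffactE (G : col3) c : (2 <= cn G)%N ->
  rho R G c = (2 * ecount G c)%:R / (cn G)%:R ^+ 2 / ffact_defect (cn G) 2 * 1.
Proof.
move=> n2; rewrite /rho /ffact_defect mulr1 invf_div -mulrA mulKf; last first.
  by rewrite expf_neq0 // pnatr_eq0 -lt0n ltnW.
rewrite -bin_ffact mulnC !natrM invfM -mulrA; congr (_ * _).
by rewrite mulrCA divff ?mulr1 // pnatr_eq0.
Qed.

Lemma cvg_rho (Gs : nat -> col3) c (x : R) :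
  (cn (Gs n))%:R @[n --> \oo] --> (+oo : set_system R) ->
  (2 * ecount (Gs n) c)%:R / (cn (Gs n))%:R ^+ 2 @[n --> \oo] --> x ->
  rho R (Gs n) c @[n --> \oo] --> x.
Proof.
move=> Gs_oo Gs_x; rewrite -[X in _ --> X]mulr1.
have /cvgryPge /(_ 2) big := Gs_oo.
apply: cvg_trans (cvg_div_ffact_defect 2 (C := 1) Gs_oo Gs_x); apply: near_eq_cvg.
near=> n; rewrite -rho_ffactE //; have : 2 <= (cn (Gs n))%:R :> R by near: n.
by rewrite ler_nat.
Unshelve. all: by end_near.
Qed.

Lemma cvg_truncn_ratio (alpha : R) : 0 <= alpha ->
  (Num.truncn (alpha * n%:R))%:R / n%:R @[n --> \oo] --> alpha.
Proof.
move=> alpha_ge0.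
have inv0 : (n%:R : R)^-1 @[n --> \oo] --> (0 : R).
  apply/gtr0_cvgV0; last exact: cvgr_idn.
  by near=> n; rewrite ltr0n; near: n; exact: nbhs_infty_gt.
apply: (@squeeze_cvgr _ _ _ _ (fun n => alpha - n%:R^-1) (fun n => alpha)).
- near=> n; have n_gt0 : 0 < n%:R :> R by rewrite ltr0n; near: n; exact: nbhs_infty_gt.
  have /andP[le_a lt_a] := truncn_itv (mulr_ge0 alpha_ge0 (ltW n_gt0)).
  rewrite ler_pdivlMr // ler_pdivrMr // le_a andbT mulrBl mulVf ?gt_eqF //.
  by rewrite lerBlDr natr1 ltW.
- by rewrite -[X in _ --> X]subr0; apply: cvgB => //; exact: cvg_cst.
- exact: cvg_cst.
Unshelve. all: by end_near.
Qed.

(** * Limit densities of the two-clique constructions *)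

Section TwoCliquesSeq.
Variables (alpha beta : R) (c0 : color).
Hypotheses (alpha_ge0 : 0 <= alpha) (beta_ge0 : 0 <= beta) (le1 : alpha + beta <= 1).

Let a (n : nat) := Num.truncn (alpha * n%:R).
Let b (n : nat) := Num.truncn (beta * n%:R).

Definition two_cliques_seq (n : nat) : col3 :=
  two_cliques (ord_interval n 0 (a n)) (ord_interval n (a n) (b n)) c0.

Let ab_le n : (a n + b n <= n)%N.
Proof.
have n_ge0 : 0 <= n%:R :> R by [].
have la : (a n)%:R <= alpha * n%:R :> R by rewrite truncn_le mulr_ge0.
have lb : (b n)%:R <= beta * n%:R :> R by rewrite truncn_le mulr_ge0.
rewrite -(ler_nat R) natrD (le_trans (lerD la lb)) // -mulrDl.
by rewrite -[leRHS]mul1r ler_wpM2r.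
Qed.

Let card_a n : #|ord_interval n 0 (a n)| = a n.
Proof. by rewrite card_ord_interval // (leq_trans _ (ab_le n)) // leq_addr. Qed.

Let card_b n : #|ord_interval n (a n) (b n)| = b n.
Proof. by rewrite card_ord_interval. Qed.

Let cvg_a : (a n)%:R / n%:R @[n --> \oo] --> alpha.
Proof. exact: cvg_truncn_ratio. Qed.

Let cvg_b : (b n)%:R / n%:R @[n --> \oo] --> beta.
Proof. exact: cvg_truncn_ratio. Qed.

Let cvg_n : n%:R @[n --> \oo] --> (+oo : set_system R).
Proof. exact: cvgr_idn. Qed.

Lemma cn_two_cliques_seq : (cn (two_cliques_seq n))%:R @[n --> \oo] --> (+oo : set_system R).
Proof. exact: cvg_n. Qed.

Lemma cvg_rho_two_cliques_blue : c0 != blue ->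
  rho R (two_cliques_seq n) blue @[n --> \oo] --> alpha ^+ 2.
Proof.
move=> c0b; apply: cvg_rho cn_two_cliques_seq _.
under eq_fun do rewrite ecount_two_cliques_blue // card_a.
exact: cvg_ffact_ratio cvg_n cvg_a.
Qed.

Lemma cvg_rho_two_cliques_green_c0red : c0 = red ->
  rho R (two_cliques_seq n) green @[n --> \oo] --> beta ^+ 2.
Proof.
move=> c0r; apply: cvg_rho cn_two_cliques_seq _.
under eq_fun do rewrite ecount_two_cliques_green // ?disjoint_ord_interval // card_b.
exact: cvg_ffact_ratio cvg_n cvg_b.
Qed.

Lemma cvg_rho_two_cliques_red : c0 = green ->
  rho R (two_cliques_seq n) red @[n --> \oo] --> 2 * (alpha * beta).
Proof.
move=> c0g; apply: cvg_rho cn_two_cliques_seq _.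
under eq_fun do rewrite ecount_two_cliques_red // ?disjoint_ord_interval //
  card_a card_b !natrM expr2 invfM -mulrA mulrACA.
by apply: cvgMr; apply: cvgM.
Qed.

(** Green now also covers the edges leaving both cliques, so it is obtained as what blue and red
    leave over. *)
Lemma cvg_rho_two_cliques_green_c0green : c0 = green ->
  rho R (two_cliques_seq n) green @[n --> \oo] --> 1 - alpha ^+ 2 - 2 * (alpha * beta).
Proof.
move=> c0g; apply: cvg_trans (cvgB (cvgB (cvg_cst (1 : R)) (cvg_rho_two_cliques_blue _))
  (cvg_rho_two_cliques_red c0g)); last by rewrite c0g.
apply: near_eq_cvg; near=> n.
have n2 : (2 <= n)%N by near: n; exact: nbhs_infty_ge.
have := @rho_sum (two_cliques_seq n) n2.
by rewrite !fctE => H; lra.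
Unshelve. all: by end_near.
Qed.

Lemma hom_density_two_cliques_ge s t n : (0 < s)%N ->
  (a n ^_ s)%:R / n%:R ^+ s * ((b n ^_ t)%:R / n%:R ^+ t)
  <= hom_density s t (two_cliques_seq n).
Proof.
move=> s_gt0; rewrite /hom_density /= exprD mulrACA -invfM -natrM.
rewrite ler_wpM2r ?invr_ge0 ?mulr_ge0 ?exprn_ge0 // ler_nat.
rewrite -!bin_ffact mulnACA leq_mul2r; apply/orP; right.
by rewrite -{1}card_a -{1}card_b N3_two_cliques_ge ?disjoint_ord_interval.
Qed.

Lemma I3_eq_two_cliques s t (xb xg L : R) (U : col3 -> R) : (0 < s)%N ->
  (forall G, (2 <= cn G)%N -> hom_density s t G <= U G) ->
  (forall Hs : nat -> col3,
     rho R (Hs n) blue @[n --> \oo] --> xb -> rho R (Hs n) green @[n --> \oo] --> xg ->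
     U (Hs n) @[n --> \oo] --> L) ->
  rho R (two_cliques_seq n) blue @[n --> \oo] --> xb ->
  rho R (two_cliques_seq n) green @[n --> \oo] --> xg ->
  L = alpha ^+ s * beta ^+ t ->
  I3 (Kst s t) xb xg = L * 'C(s + t, s)%:R.
Proof.
move=> s_gt0 leU cvgU seq_b seq_g LE.
apply: (I3_eq leU cvgU cn_two_cliques_seq seq_b seq_g
  (fun n => hom_density_two_cliques_ge t n s_gt0)).
by rewrite LE; apply: cvgM; exact: cvg_ffact_ratio.
Qed.

End TwoCliquesSeq.

End Limits.

(** * The two regimes *)

Theorem theorem3 (R : realType) (s t : nat) (xb xg xr : R) :
  (2 <= s)%N -> (s <= t)%N ->
  0 <= xb <= 1 -> 0 <= xg <= 1 -> 0 <= xr <= 1 -> xb + xg + xr = 1 ->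
  (Num.sqrt xb + Num.sqrt xg <= 1 ->
     I3 (Kst s t) xb xg = xb `^ (s%:R / 2) * xg `^ (t%:R / 2) * ('C(s + t, s))%:R) /\
  (1 < Num.sqrt xb + Num.sqrt xg ->
     I3 (Kst s s) xb xg = (xr / 2) ^+ s * ('C(s + s, s))%:R).
Proof.
move=> s2 st /andP[xb0 xb1] /andP[xg0 xg1] /andP[xr0 xr1] sum1.
have powE (x : R) k : 0 <= x -> x `^ (k%:R / 2) = Num.sqrt x ^+ k.
  by move=> x0; rewrite mulrC powRrM powR12_sqrt // powR_mulrn ?sqrtr_ge0.
have bE := sqr_sqrtr xb0; have gE := sqr_sqrtr xg0.
have b0 := sqrtr_ge0 xb; have g0 := sqrtr_ge0 xg.
split=> [le1|gt1].
  rewrite !powE //.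
  apply: (@I3_eq_two_cliques _ _ _ red b0 g0 le1 _ _ _ _ _
    (fun G => Num.sqrt (rho R G blue) ^+ s * Num.sqrt (rho R G green) ^+ t)) => //.
  - exact: ltnW.
  - by move=> G n2; apply: hom_density_le_cliques => //; exact: leq_trans st.
  - move=> Hs Hb Hg; apply: cvgM; apply: cvg_expr;
      by apply: cvg_comp; [eassumption | exact: sqrt_continuous].
  - by rewrite -{2}bE; apply: cvg_rho_two_cliques_blue.
  - by rewrite -{2}gE; apply: cvg_rho_two_cliques_green_c0red.
set p := Num.sqrt xb in bE b0 gt1 *; set q := Num.sqrt xg in gE g0 gt1 *.
(* With [p + q > 1] this forces [p > 0], which allows the division by [p] in [r]. *)
have q1 : q <= 1 by rewrite -sqrtr1 ler_sqrt.
have p_gt0 : 0 < p by lra.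
(* Chosen so that the red density [2 * (p * r)] of the construction equals [xr]. *)
pose r := xr / (2 * p).
have r0 : 0 <= r by rewrite divr_ge0 // mulr_ge0.
have pr : p * r = xr / 2 by rewrite /r; field; rewrite gt_eqF.
have le1 : p + r <= 1.
  (* As [xr = 1 - p ^ 2 - q ^ 2], the claim multiplied by [2 * p] amounts to [(1 - p) ^ 2 <= q ^ 2],
     which follows from [0 <= 1 - p < q]. *)
  rewrite -(ler_pM2l p_gt0) mulrDr pr.
  nra.
apply: (@I3_eq_two_cliques _ _ _ green b0 r0 le1 _ _ _ _ _
  (fun G => ((1 - rho R G blue - rho R G green) / 2) ^+ s)) => //.
- exact: ltnW.
- by move=> G n2; apply: hom_density_le_red.
- move=> Hs Hb Hg; apply: cvg_expr; apply: cvgMl.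
  have -> : xr = 1 - xb - xg by lra.
  by apply: cvgB => //; apply: cvgB => //; exact: cvg_cst.
- by rewrite -bE; apply: cvg_rho_two_cliques_blue.
- have -> : xg = 1 - p ^+ 2 - 2 * (p * r) by rewrite pr bE; lra.
  exact: cvg_rho_two_cliques_green_c0green.
- by rewrite -exprMn pr.
Qed.
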